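(* For every positive integer $\mathfrak{s}$ there exists a partial order $\mathcal P$ whose number of siblings, counted up to isomorphism, is exactly $\mathfrak{s}$.
   Context: An embedding of a partial order $(P,\le_P)$ into a partial order $(Q,\le_Q)$ is an injective map $f:P\to Q$ such that for all $x,y\in P$, $x\le_P y$ if and only if $f(x)\le_Q f(y)$. Two partial orders are siblings (equimorphic) if each embeds into the other. The number of siblings of $\mathcal P$ is the number of isomorphism classes of partial orders equimorphic to $\mathcal P$. *)

(* Defs.v *)
From Stdlib Require Import Relation_Definitions FinFun Fin.

Record PartialOrder : Type := {
  carrier :> Type;
  le : relation carrier;
  le_order : order carrier le
}.

Definition is_embedding (P Q : PartialOrder) (f : P -> Q) : Prop :=
  Injective f /\ forall x y : P, le P x y <-> le Q (f x) (f y).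

Definition embeds (P Q : PartialOrder) : Prop :=
  exists f : P -> Q, is_embedding P Q f.

Definition siblings (P Q : PartialOrder) : Prop :=
  embeds P Q /\ embeds Q P.

Definition isomorphic (P Q : PartialOrder) : Prop :=
  exists f : P -> Q,
    Bijective f /\ forall x y : P, le P x y <-> le Q (f x) (f y).

(* The isomorphism classes of siblings of [P] form a set with exactly [n]
   elements: [Q] is a complete system of pairwise non-isomorphic
   representatives. *)
Definition number_of_siblings_is (P : PartialOrder) (n : nat) : Prop :=
  exists Q : Fin.t n -> PartialOrder,
    (forall i, siblings P (Q i)) /\
    (forall i j, isomorphic (Q i) (Q j) -> i = j) /\
    (forall R : PartialOrder, siblings P R -> exists i, isomorphic R (Q i)).

(* Main.v *)
(* Let G be a group of permutations of a countable set J. Take one column for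
   each n in J, and above the columns one point for each c in G, whose downset in
   column n records c(n). The columns are copies of a rigid infinite interval
   order, except that those with n in a set B contain one additional point.
   Rigidity makes every embedding between such orders act on the columns as a
   permutation, and comparing the points for c with their images shows that it
   lies in G. Hence the siblings of the order marked by B are the orders marked
   by sets between g(B) and B with g in G, and two of them are isomorphic exactly
   when some element of G maps one set to the other.

   It remains to find G and B for which these sets form s orbits: G consists of
   the permutations of Z that agree with the translation by some multiple of s
   off a finite set, and B is the set of nonnegative integers. The sets in
   question are then classified by the size modulo s of their complement in B. *)

Require Import Defs.
From Stdlib Require Import Relation_Definitions FinFun ZArith Lia List.
From Stdlib Require Import ClassicalEpsilon FunctionalExtensionality.

(** * Embeddings and suborders *)

Lemma le_iff_injective (P Q : PartialOrder) (f : P -> Q) :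
  (forall x y, le P x y <-> le Q (f x) (f y)) -> Injective f.
Proof.
  intros Hf x y E.
  apply (ord_antisym _ _ (le_order P)); apply Hf; rewrite E;
    apply (ord_refl _ _ (le_order Q)).
Qed.

Lemma isomorphic_embeds (P Q : PartialOrder) : isomorphic P Q -> embeds P Q.
Proof.
  intros [f [_ Hf]]. exists f. split; [now apply le_iff_injective | exact Hf].
Qed.

Lemma embeds_trans (P Q R : PartialOrder) :
  embeds P Q -> embeds Q R -> embeds P R.
Proof.
  intros [f [f_inj Hf]] [g [g_inj Hg]]. exists (fun x => g (f x)). split.
  - intros x y E. now apply f_inj, g_inj.
  - intros x y. now rewrite Hf, Hg.
Qed.

Lemma isomorphic_trans (P Q R : PartialOrder) :
  isomorphic P Q -> isomorphic Q R -> isomorphic P R.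
Proof.
  intros [f [[f' [f'f ff']] Hf]] [g [[g' [g'g gg']] Hg]].
  exists (fun x => g (f x)). split.
  - exists (fun x => f' (g' x)). split; congruence.
  - intros x y. now rewrite Hf, Hg.
Qed.

Lemma surjective_embedding_isomorphic (P Q : PartialOrder) (f : P -> Q) :
  is_embedding P Q f -> Surjective f -> isomorphic P Q.
Proof.
  intros [f_inj Hf] f_surj. exists f. split; [|exact Hf].
  set (f' y := proj1_sig (constructive_indefinite_description _ (f_surj y))).
  assert (ff' : forall y, f (f' y) = y) by (intros y; apply proj2_sig).
  exists f'. split; [intros x; apply f_inj, ff' | exact ff'].
Qed.

Lemma sig_eq {T : Type} (S : T -> Prop) (u v : {x | S x}) :
  proj1_sig u = proj1_sig v -> u = v.
Proof. apply eq_sig_hprop. intros. apply proof_irrelevance. Qed.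

Lemma suborder_order (P : PartialOrder) (S : P -> Prop) :
  order {x | S x} (fun u v => le P (proj1_sig u) (proj1_sig v)).
Proof.
  destruct (le_order P) as [refl trans antisym]. split.
  - intros u. apply refl.
  - intros u v w. apply trans.
  - intros u v Huv Hvu. now apply sig_eq, antisym.
Qed.

Definition suborder (P : PartialOrder) (S : P -> Prop) : PartialOrder :=
  {| carrier := {x | S x};
     le := fun u v => le P (proj1_sig u) (proj1_sig v);
     le_order := suborder_order P S |}.

Definition embedding_on {P : PartialOrder} (S T : P -> Prop) (f : P -> P) : Prop :=
  (forall x, S x -> T (f x)) /\
  (forall x y, S x -> S y -> le P x y <-> le P (f x) (f y)).

Lemma embedding_on_injective (P : PartialOrder) (S T : P -> Prop) (f : P -> P)
    (x y : P) :
  embedding_on S T f -> S x -> S y -> f x = f y -> x = y.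
Proof.
  intros [_ Hle] Hx Hy E.
  assert (f_inj : Injective (fun u : suborder P S => f (proj1_sig u))).
  { apply (le_iff_injective (suborder P S) P).
    intros [u Hu] [v Hv]. now apply Hle. }
  exact (f_equal (@proj1_sig _ _) (f_inj (exist _ x Hx) (exist _ y Hy) E)).
Qed.

Lemma embedding_on_restrict (P : PartialOrder) (S T : P -> Prop) (f : P -> P) :
  embedding_on S T f ->
  exists F : suborder P S -> suborder P T,
    is_embedding _ _ F /\ forall u, proj1_sig (F u) = f (proj1_sig u).
Proof.
  intros [Hdom Hle].
  exists (fun u => exist _ (f (proj1_sig u)) (Hdom _ (proj2_sig u))).
  split; [|reflexivity].
  assert (H : forall u v : suborder P S, le _ u v <->
            le P (f (proj1_sig u)) (f (proj1_sig v)))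
    by (intros [x Hx] [y Hy]; now apply Hle).
  split; [apply le_iff_injective|]; exact H.
Qed.

Lemma embedding_on_extend (P : PartialOrder) (S T : P -> Prop)
    (F : suborder P S -> suborder P T) :
  (forall u v, le _ u v <-> le _ (F u) (F v)) ->
  exists f, embedding_on S T f /\ forall u, proj1_sig (F u) = f (proj1_sig u).
Proof.
  intros HF.
  set (f x := match excluded_middle_informative (S x) with
              | left Hx => proj1_sig (F (exist _ x Hx)) | right _ => x end).
  assert (Hf : forall x (Hx : S x), f x = proj1_sig (F (exist _ x Hx))).
  { intros x Hx. unfold f.
    destruct (excluded_middle_informative (S x)) as [Hx'|]; [|contradiction].
    now rewrite (proof_irrelevance _ Hx Hx'). }
  exists f. split; [split|].
  - intros x Hx. rewrite (Hf x Hx). apply proj2_sig.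
  - intros x y Hx Hy. rewrite (Hf x Hx), (Hf y Hy).
    apply (HF (exist _ x Hx) (exist _ y Hy)).
  - intros [x Hx]. symmetry. apply Hf.
Qed.

Lemma embeds_suborder_iff (P : PartialOrder) (S T : P -> Prop) :
  embeds (suborder P S) (suborder P T) <-> exists f, embedding_on S T f.
Proof.
  split.
  - intros [F [_ HF]]. destruct (embedding_on_extend P S T F HF) as [f [Hf _]].
    now exists f.
  - intros [f Hf]. destruct (embedding_on_restrict P S T f Hf) as [F [HF _]].
    now exists F.
Qed.

Lemma isomorphic_suborder_iff (P : PartialOrder) (S T : P -> Prop) :
  isomorphic (suborder P S) (suborder P T) <->
  exists f, embedding_on S T f /\ forall y, T y -> exists x, S x /\ f x = y.
Proof.
  split.
  - intros [F [[F' [_ FF']] HF]].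
    destruct (embedding_on_extend P S T F HF) as [f [Hf E]].
    exists f. split; [exact Hf|]. intros y Hy.
    exists (proj1_sig (F' (exist _ y Hy))). split; [apply proj2_sig|].
    now rewrite <- E, FF'.
  - intros [f [Hf f_surj]].
    destruct (embedding_on_restrict P S T f Hf) as [F [HF E]].
    apply (surjective_embedding_isomorphic _ _ F HF). intros [y Hy].
    destruct (f_surj y Hy) as [x [Hx <-]].
    exists (exist _ x Hx). apply sig_eq, E.
Qed.

Lemma isomorphic_suborder_ext (P : PartialOrder) (S T : P -> Prop) :
  (forall x, S x <-> T x) -> isomorphic (suborder P S) (suborder P T).
Proof.
  intros HST. apply isomorphic_suborder_iff. exists (fun x => x).
  split; [split|].
  - apply HST.
  - reflexivity.
  - intros y Hy. exists y. split; [now apply HST | reflexivity].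
Qed.

Lemma embeds_suborder_isomorphic (P R : PartialOrder) (S : P -> Prop) :
  embeds R (suborder P S) ->
  exists T : P -> Prop, (forall x, T x -> S x) /\ isomorphic R (suborder P T).
Proof.
  intros [F [F_inj HF]]. exists (fun x => exists r, proj1_sig (F r) = x). split.
  - intros x [r <-]. apply proj2_sig.
  - apply surjective_embedding_isomorphic with
      (fun r => exist _ (proj1_sig (F r)) (ex_intro _ r eq_refl)).
    + split; [apply le_iff_injective|]; exact HF.
    + intros [x [r Hr]]. exists r. now apply sig_eq.
Qed.

Lemma siblings_suborder (P R : PartialOrder) (S : P -> Prop) :
  siblings (suborder P S) R ->
  exists T : P -> Prop, (forall x, T x -> S x) /\
    isomorphic R (suborder P T) /\ exists f, embedding_on S T f.
Proof.
  intros [HSR HRS].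
  destruct (embeds_suborder_isomorphic P R S HRS) as [T [HTS HRT]].
  exists T. split; [exact HTS|]. split; [exact HRT|].
  apply embeds_suborder_iff, (embeds_trans _ _ _ HSR), isomorphic_embeds, HRT.
Qed.

(** * Rigid columns *)

(* A column is the interval order of [j, j + 1] for all j, together with the
   degenerate intervals [3, 3] and, optionally, [2, 2]. *)
Inductive column : Type :=
  | Step (j : nat)
  | Pin
  | Mark.

Definition lo (x : column) : nat :=
  match x with Step j => j | Pin => 3 | Mark => 2 end.

Definition hi (x : column) : nat :=
  match x with Step j => S j | Pin => 3 | Mark => 2 end.

Lemma lo_le_hi (x : column) : lo x <= hi x.
Proof. destruct x; simpl; lia. Qed.

Section ColumnRigidity.

Variables (D : column -> Prop) (a : column -> column).
Hypothesis D_unmarked : forall x, x <> Mark -> D x.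
Hypothesis a_lt : forall x y, D x -> D y -> hi x < lo y <-> hi (a x) < lo (a y).

Lemma unmarked_step (j : nat) : D (Step j).
Proof. now apply D_unmarked. Qed.

Lemma column_step_lt (i j : nat) : S i < j <-> hi (a (Step i)) < lo (a (Step j)).
Proof. apply (a_lt (Step i) (Step j)); apply unmarked_step. Qed.

(* [Step (S j)] meets two disjoint intervals, hence is not degenerate. *)
Lemma column_embedding_nondegenerate (j : nat) :
  exists i, a (Step (S j)) = Step i.
Proof.
  pose proof (column_step_lt j (S (S j))).
  pose proof (column_step_lt j (S j)).
  pose proof (column_step_lt (S j) (S (S j))).
  destruct (a (Step (S j))) as [i| |]; [now exists i | simpl in *; lia..].
Qed.

Lemma column_embedding_translates :
  exists i, forall j, a (Step (S j)) = Step (i + j).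
Proof.
  destruct (column_embedding_nondegenerate 0) as [i Hi]. exists i.
  induction j as [|j IH]; [now rewrite Nat.add_0_r|].
  destruct (column_embedding_nondegenerate (S j)) as [k Hk].
  destruct (column_embedding_nondegenerate (S (S j))) as [l Hl].
  pose proof (column_step_lt (S j) (S (S j))) as Hjk.
  pose proof (column_step_lt (S j) (S (S (S j)))) as Hjl.
  pose proof (column_step_lt (S (S j)) (S (S (S j)))) as Hkl.
  rewrite IH, Hk in Hjk. rewrite IH, Hl in Hjl. rewrite Hk, Hl in Hkl.
  rewrite Hk. simpl in *. f_equal. lia.
Qed.

(* The image of [Pin] is a degenerate interval, so the translation is by 0 or by
   -1; there is no room for [Step 0] in the latter case. *)
Lemma column_embedding_unmarked :
  a Pin = Pin /\ forall j, a (Step j) = Step j.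
Proof.
  destruct column_embedding_translates as [i Hi].
  pose proof (column_step_lt 0 2) as Hstart. rewrite Hi in Hstart.
  assert (D_pin : D Pin) by now apply D_unmarked.
  pose proof (a_lt (Step 1) Pin (unmarked_step 1) D_pin) as Hbelow.
  pose proof (a_lt Pin (Step 4) D_pin (unmarked_step 4)) as Habove.
  rewrite Hi in Hbelow, Habove. simpl in Hstart, Hbelow, Habove.
  assert (i = 1 /\ a Pin = Pin) as [-> Hpin].
  { pose proof (lo_le_hi (a Pin)).
    destruct (a (Step 0)), (a Pin); simpl in *; split; reflexivity || lia. }
  split; [exact Hpin|]. intros [|j]; [|apply Hi].
  destruct (a (Step 0)); simpl in *; f_equal; lia.
Qed.

Lemma column_embedding_id (x : column) : D x -> a x = x.
Proof.
  destruct column_embedding_unmarked as [Hpin Hstep].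
  destruct x as [j| |]; [intros _; apply Hstep | intros _; exact Hpin |].
  intros D_mark.
  pose proof (a_lt (Step 0) Mark (unmarked_step 0) D_mark) as Hbelow.
  pose proof (a_lt Mark (Step 3) D_mark (unmarked_step 3)) as Habove.
  rewrite Hstep in Hbelow, Habove. destruct (a Mark); simpl in *; reflexivity || lia.
Qed.

End ColumnRigidity.

(** * Marked orders *)

Definition inverses {J : Type} (g h : J -> J) : Prop :=
  (forall n, h (g n) = n) /\ (forall n, g (h n) = n).

Lemma inverses_sym {J : Type} (g h : J -> J) : inverses g h -> inverses h g.
Proof. now intros [hg gh]. Qed.

Record permutation_group {J : Type} (G : (J -> J) -> Prop) : Prop := {
  group_id : G (fun n => n);
  group_comp : forall g h, G g -> G h -> G (fun n => g (h n));
  group_inverse : forall g, G g -> exists h, G h /\ inverses g h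
}.

Definition same_orbit {J : Type} (G : (J -> J) -> Prop) (B B' : J -> Prop) : Prop :=
  exists g, G g /\ forall n, B n <-> B' (g n).

Lemma same_orbit_trans {J : Type} (G : (J -> J) -> Prop) (A B C : J -> Prop) :
  permutation_group G -> same_orbit G A B -> same_orbit G B C -> same_orbit G A C.
Proof.
  intros HG [g [Hg HAB]] [h [Hh HBC]]. exists (fun n => h (g n)).
  split; [now apply (group_comp G HG) | intros n; now rewrite HAB].
Qed.

Section MarkedOrders.

Context {J : Type} (code : J -> nat) (G : (J -> J) -> Prop).

Inductive point : Type :=
  | Perm (c : J -> J)
  | Col (n : J) (x : column).

Definition lt_point (p q : point) : Prop :=
  match p, q with
  | Col n x, Col m y => n = m /\ hi x < lo y
  | Col n x, Perm c => lo x <= code (c n)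
  | Perm _, _ => False
  end.

Lemma lt_point_irrefl (p : point) : ~ lt_point p p.
Proof.
  destruct p as [c|n x]; simpl; [tauto|]. pose proof (lo_le_hi x). lia.
Qed.

Lemma lt_point_trans (p q r : point) : lt_point p q -> lt_point q r -> lt_point p r.
Proof.
  destruct p as [c|n x], q as [d|m y], r as [e|l z]; simpl; try tauto;
    pose proof (lo_le_hi x); pose proof (lo_le_hi y).
  - intros [-> Hxy]. lia.
  - intros [-> Hxy] [-> Hyz]. split; [reflexivity | lia].
Qed.

Lemma points_order : order point (fun p q => p = q \/ lt_point p q).
Proof.
  split.
  - now left.
  - intros p q r [->|Hpq] [->|Hqr]; auto. right. now apply lt_point_trans with q.
  - intros p q [->|Hpq] [E|Hqp]; auto.
    destruct (lt_point_irrefl p). now apply lt_point_trans with q.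
Qed.

Definition points : PartialOrder :=
  {| carrier := point; le := fun p q => p = q \/ lt_point p q;
     le_order := points_order |}.

Lemma lt_point_iff (p q : point) : lt_point p q <-> le points p q /\ p <> q.
Proof.
  simpl. split; [|tauto]. intros H. split; [now right|]. intros ->.
  now apply lt_point_irrefl in H.
Qed.

Definition marked_points (B : J -> Prop) (p : points) : Prop :=
  match p with
  | Perm c => G c
  | Col n Mark => B n
  | Col _ _ => True
  end.

Definition marked_order (B : J -> Prop) : PartialOrder :=
  suborder points (marked_points B).

(* Meant for [h] the inverse of [g]. *)
Definition act (g h : J -> J) (p : points) : points :=
  match p with
  | Perm c => Perm (fun n => c (h n))
  | Col n x => Col (g n) x
  end.

Lemma act_cancel (g h : J -> J) (p : points) :
  inverses g h -> act g h (act h g p) = p.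
Proof.
  intros [hg gh]. destruct p as [c|n x]; simpl; f_equal; [|apply gh].
  apply functional_extensionality. intros n. now rewrite gh.
Qed.

Hypotheses (HG : permutation_group G) (code_injective : Injective code).

Lemma act_marked_points (g h : J -> J) (B B' : J -> Prop) (p : points) :
  G h -> (forall n, B n -> B' (g n)) ->
  marked_points B p -> marked_points B' (act g h p).
Proof.
  intros Hh HB. destruct p as [c|n []]; simpl; auto.
  intros Hc. now apply (group_comp G HG c h).
Qed.

Lemma lt_point_act (g h : J -> J) (p q : point) :
  inverses g h -> lt_point p q <-> lt_point (act g h p) (act g h q).
Proof.
  intros [hg gh]. destruct p as [c|n x], q as [d|m y]; simpl; try tauto.
  - now rewrite hg.
  - split; intros [E H]; split; congruence.
Qed.

Lemma act_embedding_on (g h : J -> J) (B B' : J -> Prop) :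
  inverses g h -> G h -> (forall n, B n -> B' (g n)) ->
  embedding_on (marked_points B) (marked_points B') (act g h).
Proof.
  intros Hgh Hh HB. split.
  - intros p. now apply act_marked_points.
  - intros p q _ _. simpl. rewrite <- lt_point_act by exact Hgh.
    assert (act g h p = act g h q -> p = q); [|intuition congruence].
    intros E. apply inverses_sym in Hgh.
    now rewrite <- (act_cancel h g p Hgh), E, act_cancel.
Qed.

Section Embedding.

Variables (B B' : J -> Prop) (f : points -> points).
Hypothesis Hf : embedding_on (marked_points B) (marked_points B') f.

Lemma embedding_lt (p q : points) :
  marked_points B p -> marked_points B q -> lt_point p q <-> lt_point (f p) (f q).
Proof.
  intros Hp Hq. rewrite !lt_point_iff, <- (proj2 Hf) by assumption.
  pose proof (embedding_on_injective _ _ _ f p q Hf Hp Hq). intuition congruence.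
Qed.

Definition maps_column (n m : J) : Prop :=
  forall x, marked_points B (Col n x) -> f (Col n x) = Col m x.

Lemma embedding_lt_step (n : J) (x : column) (j : nat) :
  marked_points B (Col n x) -> hi x < j ->
  lt_point (f (Col n x)) (f (Col n (Step j))).
Proof.
  intros Hx Hj. apply (embedding_lt (Col n x) (Col n (Step j)) Hx I). now split.
Qed.

(* Column points are not maximal, whereas the [Perm]s are. *)
Lemma embedding_col (n : J) (x : column) :
  marked_points B (Col n x) -> exists m y, f (Col n x) = Col m y.
Proof.
  intros Hx. pose proof (embedding_lt_step n x (S (hi x)) Hx (le_n _)) as H.
  destruct (f (Col n x)) as [c|m y]; [contradiction | now exists m, y].
Qed.

(* Any two points of a column have a common upper bound in it. *)
Lemma embedding_into_column (n : J) :
  exists m, forall x, marked_points B (Col n x) -> exists y, f (Col n x) = Col m y.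
Proof.
  destruct (embedding_col n (Step 0) I) as [m [y0 E0]]. exists m. intros x Hx.
  destruct (embedding_col n x Hx) as [m' [y E]]. exists y.
  set (j := S (S (hi x))).
  destruct (embedding_col n (Step j) I) as [m'' [z Ez]].
  assert (Hxj : lt_point (f (Col n x)) (f (Col n (Step j))))
    by (apply embedding_lt_step; [exact Hx | unfold j; lia]).
  assert (Hbase : lt_point (f (Col n (Step 0))) (f (Col n (Step j))))
    by (apply embedding_lt_step; [exact I | unfold j; simpl; lia]).
  rewrite E, Ez in Hxj. rewrite E0, Ez in Hbase. destruct Hxj, Hbase. congruence.
Qed.

Lemma embedding_maps_column (n : J) : exists m, maps_column n m.
Proof.
  destruct (embedding_into_column n) as [m Hm]. exists m.
  set (a x := match f (Col n x) with Col _ y => y | Perm _ => x end).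
  assert (Ha : forall x, marked_points B (Col n x) -> f (Col n x) = Col m (a x)).
  { intros x Hx. unfold a. destruct (Hm x Hx) as [y Hy]. now rewrite Hy. }
  intros x Hx. rewrite (Ha x Hx). f_equal.
  apply (column_embedding_id (fun x => marked_points B (Col n x))); [| |exact Hx].
  - intros []; simpl; tauto || congruence.
  - intros y z Hy Hz. pose proof (embedding_lt (Col n y) (Col n z) Hy Hz) as H.
    rewrite (Ha y Hy), (Ha z Hz) in H. simpl in H. tauto.
Qed.

(* A column point lies below almost all steps of its column. *)
Lemma embedding_perm_neq_col (c : J -> J) (m : J) (y : column) :
  G c -> f (Perm c) <> Col m y.
Proof.
  intros Hc E. destruct (embedding_maps_column m) as [m' Hm].
  assert (Hlow : lt_point (f (Col m (Step 0))) (f (Perm c)))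
    by (apply (embedding_lt (Col m (Step 0)) (Perm c) I Hc), Nat.le_0_l).
  rewrite E, Hm in Hlow by exact I. destruct Hlow as [-> _].
  assert (Hhigh : lt_point (f (Perm c)) (f (Col m (Step (S (hi y))))))
    by (rewrite E, Hm by exact I; split; [reflexivity | apply le_n]).
  now apply embedding_lt in Hhigh.
Qed.

Lemma embedding_perm (c : J -> J) :
  G c -> exists d, f (Perm c) = Perm d /\ forall n m, maps_column n m -> d m = c n.
Proof.
  intros Hc. destruct (f (Perm c)) as [d|m y] eqn:E;
    [|now apply embedding_perm_neq_col in E].
  exists d. split; [reflexivity|]. intros n m Hnm. apply code_injective.
  assert (H : forall j, j <= code (c n) <-> j <= code (d m)).
  { intros j. pose proof (embedding_lt (Col n (Step j)) (Perm c) I Hc) as H.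
    now rewrite E, Hnm in H. }
  apply Nat.le_antisymm; apply H; reflexivity.
Qed.

Theorem embedding_act :
  exists g h, G g /\ G h /\ inverses g h /\
    forall p, marked_points B p -> f p = act g h p.
Proof.
  destruct (embedding_perm _ (group_id G HG)) as [h [Eh Hh]].
  assert (Gh : G h).
  { pose proof (proj1 Hf (Perm (fun n => n)) (group_id G HG)) as H.
    now rewrite Eh in H. }
  destruct (group_inverse G HG h Gh) as [g [Gg Hhg]].
  exists g, h. split; [exact Gg|]. split; [exact Gh|].
  split; [now apply inverses_sym|]. destruct Hhg as [gh hg].
  assert (Hcol : forall n, maps_column n (g n)).
  { intros n. destruct (embedding_maps_column n) as [m Hm].
    replace (g n) with m; [exact Hm|]. now rewrite <- (gh m), (Hh n m Hm). }
  intros [c|n x] Hp; simpl; [|now apply Hcol].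
  destruct (embedding_perm c Hp) as [d [-> Hd]]. f_equal.
  apply functional_extensionality. intros n.
  now rewrite <- (Hd (h n) (g (h n)) (Hcol _)), gh.
Qed.

End Embedding.

Theorem embeds_marked_order_iff (B B' : J -> Prop) :
  embeds (marked_order B) (marked_order B') <->
  exists g, G g /\ forall n, B n -> B' (g n).
Proof.
  unfold marked_order. rewrite embeds_suborder_iff. split.
  - intros [f Hf].
    destruct (embedding_act B B' f Hf) as [g [h [Hg [_ [_ E]]]]].
    exists g. split; [exact Hg|]. intros n Hn.
    pose proof (proj1 Hf (Col n Mark) Hn) as H. now rewrite E in H.
  - intros [g [Hg HB]]. destruct (group_inverse G HG g Hg) as [h [Hh Hgh]].
    exists (act g h). now apply act_embedding_on.
Qed.

Theorem isomorphic_marked_order_iff (B B' : J -> Prop) :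
  isomorphic (marked_order B) (marked_order B') <-> same_orbit G B B'.
Proof.
  unfold marked_order. rewrite isomorphic_suborder_iff. split.
  - intros [f [Hf f_surj]].
    destruct (embedding_act B B' f Hf) as [g [h [Hg [_ [[hg _] E]]]]].
    exists g. split; [exact Hg|]. intros n. split; intros Hn.
    + pose proof (proj1 Hf (Col n Mark) Hn) as H. now rewrite E in H.
    + destruct (f_surj (Col (g n) Mark) Hn) as [p [Hp Ep]]. rewrite E in Ep by exact Hp.
      destruct p as [c|m x]; [discriminate|]. injection Ep as Em ->.
      now rewrite <- (hg n), <- Em, hg.
  - intros [g [Hg HB]]. destruct (group_inverse G HG g Hg) as [h [Hh Hgh]].
    exists (act g h). split; [apply act_embedding_on; auto; apply HB|].
    intros q Hq. exists (act h g q). split; [|now apply act_cancel].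
    apply act_marked_points with B'; auto.
    intros n Hn. apply HB. now rewrite (proj2 Hgh).
Qed.

Theorem siblings_marked_order (A : J -> Prop) (R : PartialOrder) :
  siblings (marked_order A) R ->
  exists B : J -> Prop, isomorphic R (marked_order B) /\
    (forall n, B n -> A n) /\ exists g, G g /\ forall n, A n -> B (g n).
Proof.
  intros HR. destruct (siblings_suborder _ _ _ HR) as [T [HT [Hiso [f Hf]]]].
  destruct (embedding_act A A f) as [g [h [Hg [Hh [Hgh E]]]]].
  { split; [intros p Hp; apply HT, Hf, Hp | apply Hf]. }
  assert (T_act : forall p, marked_points A p -> T (act g h p))
    by (intros p Hp; rewrite <- E by exact Hp; now apply Hf).
  exists (fun n => T (Col n Mark)). split; [|split].
  - apply (isomorphic_trans _ _ _ Hiso), isomorphic_suborder_ext.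
    intros q. split; intros Hq.
    + destruct q as [c|n []]; [apply (HT _ Hq) | exact I.. | exact Hq].
    + assert (H : marked_points A (act h g q) -> T q)
        by (intros H; rewrite <- (act_cancel g h q Hgh); now apply T_act).
      destruct q as [c|n []]; [| now apply H.. | exact Hq].
      now apply H, (group_comp G HG c g).
  - intros n Hn. apply (HT _ Hn).
  - exists g. split; [exact Hg|]. intros n Hn. exact (T_act (Col n Mark) Hn).
Qed.

End MarkedOrders.

(** * Eventual translations of the integers *)

Section EventualShifts.

Local Open Scope Z_scope.

Definition eventually_shift (t : Z) (g : Z -> Z) : Prop :=
  exists N, forall n, N <= Z.abs n -> g n = n + t.

Definition shift_perm (s : Z) (g : Z -> Z) : Prop :=
  Bijective g /\ exists t, (s | t) /\ eventually_shift t g.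

Lemma eventually_shift_inverse (t : Z) (g h : Z -> Z) :
  inverses g h -> eventually_shift t g -> eventually_shift (- t) h.
Proof.
  intros [hg gh] [N HN]. exists (N + Z.abs t). intros n Hn.
  rewrite <- (hg (n + - t)). f_equal. rewrite HN; lia.
Qed.

Lemma eventually_shift_comp (t u : Z) (g h : Z -> Z) :
  eventually_shift t g -> eventually_shift u h ->
  eventually_shift (t + u) (fun n => g (h n)).
Proof.
  intros [N HN] [M HM]. exists (Z.max M (N + Z.abs u)). intros n Hn.
  rewrite HM, HN by lia. lia.
Qed.

Lemma shift_perm_translation (s t : Z) : (s | t) -> shift_perm s (fun n => n + t).
Proof.
  intros Ht. split.
  - exists (fun n => n - t). split; intros; lia.
  - exists t. split; [exact Ht | now exists 0].
Qed.

Lemma shift_perm_group (s : Z) : permutation_group (shift_perm s).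
Proof.
  split.
  - split; [now exists (fun n => n)|].
    exists 0. split; [apply Z.divide_0_r | exists 0; intros; lia].
  - intros g h [[g' [g'g gg']] [t [Ht Hgt]]] [[h' [h'h hh']] [u [Hu Hhu]]]. split.
    + exists (fun n => h' (g' n)). split; congruence.
    + exists (t + u). split;
        [now apply Z.divide_add_r | now apply eventually_shift_comp].
  - intros g [[h Hgh] [t [Ht Hgt]]]. exists h. split; [split|exact Hgh].
    + exists g. now apply inverses_sym.
    + exists (- t). split; [now apply Z.divide_opp_r|].
      now apply eventually_shift_inverse with g.
Qed.

Definition interval (a b : Z) : list Z :=
  map (fun k => a + Z.of_nat k) (seq 0 (Z.to_nat (b - a))).

Lemma in_interval (a b n : Z) : In n (interval a b) <-> a <= n < b.
Proof.
  unfold interval. rewrite in_map_iff. split.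
  - intros [k [<- Hk]]. apply in_seq in Hk. lia.
  - intros H. exists (Z.to_nat (n - a)). rewrite in_seq. lia.
Qed.

Lemma NoDup_interval (a b : Z) : NoDup (interval a b).
Proof.
  apply Injective_map_NoDup; [intros x y; lia | apply seq_NoDup].
Qed.

Lemma length_interval (a b : Z) : length (interval a b) = Z.to_nat (b - a).
Proof. unfold interval. now rewrite length_map, length_seq. Qed.

(* Compare the cardinalities of [i, M) and [j, M + t) for a large M. *)
Lemma eventually_shift_ray_le (t i j : Z) (g : Z -> Z) :
  Injective g -> eventually_shift t g -> (forall n, i <= n -> j <= g n) ->
  j <= i + t.
Proof.
  intros g_inj [N HN] Hg.
  set (M := Z.abs N + Z.abs i + Z.abs j + Z.abs t).
  assert (H : (length (map g (interval i M)) <= length (interval j (M + t)))%nat).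
  { apply NoDup_incl_length.
    - apply Injective_map_NoDup; [exact g_inj | apply NoDup_interval].
    - intros m Hm. apply in_map_iff in Hm. destruct Hm as [n [<- Hn]].
      apply in_interval in Hn. apply in_interval. split; [apply Hg; lia|].
      destruct (Z.lt_ge_cases (g n) (M + t)) as [|Hge]; [assumption|].
      assert (n = g n - t) by (apply g_inj; rewrite (HN (g n - t)); lia). lia. }
  rewrite length_map, !length_interval in H. lia.
Qed.

Lemma eventually_shift_ray (t i j : Z) (g : Z -> Z) :
  Bijective g -> eventually_shift t g -> (forall n, i <= n <-> j <= g n) ->
  j = i + t.
Proof.
  intros [h Hgh] Ht Hray.
  pose proof (eventually_shift_inverse t g h Hgh Ht) as Ht'.
  destruct Hgh as [hg gh]. apply Z.le_antisymm.
  - apply eventually_shift_ray_le with g; [|assumption|apply Hray].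
    intros x y E. congruence.
  - enough (i <= j + - t) by lia.
    apply eventually_shift_ray_le with h; [|assumption|].
    + intros x y E. congruence.
    + intros n Hn. apply Hray. now rewrite gh.
Qed.

Lemma same_orbit_ray_iff (s i j : Z) :
  same_orbit (shift_perm s) (Z.le i) (Z.le j) <-> (s | j - i).
Proof.
  split.
  - intros [g [[Hg [t [Hst Ht]]] Hray]].
    rewrite (eventually_shift_ray t i j g Hg Ht Hray).
    now replace (i + t - i) with t by ring.
  - intros Hs. exists (fun n => n + (j - i)).
    split; [now apply shift_perm_translation | intros n; lia].
Qed.

Definition swap (a b n : Z) : Z :=
  if n =? a then b else if n =? b then a else n.

Lemma swap_involutive (a b n : Z) : swap a b (swap a b n) = n.
Proof.
  unfold swap. destruct (Z.eqb_spec n a), (Z.eqb_spec n b);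
    repeat match goal with |- context [?x =? ?y] => destruct (Z.eqb_spec x y) end; lia.
Qed.

Lemma shift_perm_swap (s a b : Z) : shift_perm s (swap a b).
Proof.
  split.
  - exists (swap a b). split; intros n; apply swap_involutive.
  - exists 0. split; [apply Z.divide_0_r|].
    exists (1 + Z.abs a + Z.abs b). intros n Hn. unfold swap.
    destruct (Z.eqb_spec n a), (Z.eqb_spec n b); lia.
Qed.

Lemma same_orbit_swap (s a b : Z) (B : Z -> Prop) :
  same_orbit (shift_perm s) B (fun n => B (swap a b n)).
Proof.
  exists (swap a b). split; [apply shift_perm_swap|].
  intros n. now rewrite swap_involutive.
Qed.

(* If [b] is in [B], swapping it with [b + d - 1] lowers the point from which on
   [B] is full; otherwise the lower bound [b] can be raised. *)
Lemma same_orbit_almost_ray (s : Z) (d : nat) (b : Z) (B : Z -> Prop) :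
  (forall n, B n -> b <= n) -> (forall n, b + Z.of_nat d <= n -> B n) ->
  exists j, same_orbit (shift_perm s) B (Z.le j).
Proof.
  revert b B. induction d as [|d IH]; intros b B Hlo Hhi.
  - exists b, (fun n => n). split; [apply (shift_perm_group s)|].
    intros n. split; [apply Hlo | intros; apply Hhi; lia].
  - destruct (classic (B b)) as [Hb|Hb].
    + set (c := b + Z.of_nat d).
      destruct (IH b (fun n => B (swap b c n))) as [j Hj].
      * intros n Hn. apply Hlo in Hn. revert Hn. unfold swap.
        destruct (Z.eqb_spec n b), (Z.eqb_spec n c); lia.
      * intros n Hn. unfold swap.
        destruct (Z.eqb_spec n b), (Z.eqb_spec n c); try (apply Hhi; lia);
          [|exact Hb]. now replace c with b by lia.
      * exists j. apply same_orbit_trans with (fun n => B (swap b c n));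
          [apply shift_perm_group | apply same_orbit_swap | exact Hj].
    + apply (IH (b + 1)).
      * intros n Hn. assert (n <> b) by congruence. apply Hlo in Hn. lia.
      * intros n Hn. apply Hhi. lia.
Qed.

Lemma same_orbit_between_rays (s M N : Z) (B : Z -> Prop) :
  0 < s -> (forall n, B n -> M <= n) -> (forall n, N <= n -> B n) ->
  exists i, 0 <= i < s /\ same_orbit (shift_perm s) B (Z.le i).
Proof.
  intros Hs Hlo Hhi.
  destruct (same_orbit_almost_ray s (Z.to_nat (N - M)) M B) as [j Hj];
    [assumption | intros; apply Hhi; lia |].
  exists (j mod s). split; [now apply Z.mod_pos_bound|].
  apply (same_orbit_trans _ _ _ _ (shift_perm_group s) Hj), same_orbit_ray_iff.
  exists (- (j / s)). pose proof (Z.div_mod j s). lia.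
Qed.

Definition code (z : Z) : nat := Z.to_nat (Z.max (2 * z) (- 2 * z - 1)).

Lemma code_injective : Injective code.
Proof. intros x y. unfold code. lia. Qed.

Definition ray_order (s i : Z) : PartialOrder :=
  marked_order code (shift_perm s) (Z.le i).

Lemma isomorphic_ray_order_eq (s i j : Z) :
  0 <= i < s -> 0 <= j < s -> isomorphic (ray_order s i) (ray_order s j) -> i = j.
Proof.
  intros Hi Hj Hij.
  apply isomorphic_marked_order_iff, same_orbit_ray_iff in Hij;
    [|apply shift_perm_group | apply code_injective].
  destruct Hij as [k Hk]. assert (k = 0) by nia. lia.
Qed.

Lemma embeds_ray_order (s i j : Z) : 0 < s -> embeds (ray_order s i) (ray_order s j).
Proof.
  intros Hs.
  apply embeds_marked_order_iff; [apply shift_perm_group | apply code_injective |].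
  exists (fun n => n + s * Z.abs (j - i)).
  split; [apply shift_perm_translation, Z.divide_factor_l | nia].
Qed.

Lemma siblings_ray_order (s : Z) (R : PartialOrder) :
  0 < s -> siblings (ray_order s 0) R ->
  exists i, 0 <= i < s /\ isomorphic R (ray_order s i).
Proof.
  intros Hs HR.
  apply siblings_marked_order in HR;
    [|apply shift_perm_group | apply code_injective].
  destruct HR as [B [Hiso [HB0 [g [[_ [t [_ [N HN]]]] HB]]]]].
  destruct (same_orbit_between_rays s 0 (Z.abs N + Z.abs t) B Hs HB0)
    as [i [Hi Horb]].
  { intros n Hn. replace n with (g (n - t)) by (rewrite HN; lia). apply HB. lia. }
  exists i. split; [exact Hi|]. apply (isomorphic_trans _ _ _ Hiso).
  apply isomorphic_marked_order_iff;
    [apply shift_perm_group | apply code_injective | exact Horb].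
Qed.

End EventualShifts.

Theorem theorem1p2 (s : nat) (hs : 0 < s) :
  exists P : PartialOrder, number_of_siblings_is P s.
Proof.
  set (index (i : Fin.t s) := Z.of_nat (proj1_sig (Fin.to_nat i))).
  assert (index_bounds : forall i, (0 <= index i < Z.of_nat s)%Z).
  { intros i. unfold index. destruct (Fin.to_nat i). simpl. lia. }
  exists (ray_order (Z.of_nat s) 0), (fun i => ray_order (Z.of_nat s) (index i)).
  split; [|split].
  - intros i. split; apply embeds_ray_order; lia.
  - intros i j Hij.
    apply Fin.to_nat_inj, Nat2Z.inj, (isomorphic_ray_order_eq (Z.of_nat s));
      [apply index_bounds.. | exact Hij].
  - intros R HR. apply siblings_ray_order in HR; [|lia].
    destruct HR as [i [Hi Hiso]]. assert (Hlt : Z.to_nat i < s) by lia.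
    exists (Fin.of_nat_lt Hlt). unfold index. rewrite Fin.to_nat_of_nat. simpl.
    now rewrite Z2Nat.id by lia.
Qed.
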